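(* Let $N$ be an abelian normal subgroup of a group $G$, put $H = G/N$, and suppose $H^2(G/N,N)$ is trivial. Then: (1) every element of $C_1$ can be extended to an automorphism of $G$ inducing the identity on $H$; (2) every element of $C_2$ can be lifted to an automorphism of $G$ centralizing $N$.
   Context: $H=G/N$ acts on $N$ on the right by $n^{x}=g^{-1}ng$ for any $g\in G$ with $gN=x$, and $H^2(G/N,N)$ is group cohomology with respect to this action. $C_1$ is the group of all $\theta\in\mathrm{Aut}(N)$ with $\theta(n^x)=\theta(n)^x$ for all $n\in N$, $x\in H$. $C_2$ is the group of all $\phi\in\mathrm{Aut}(H)$ with $n^{\phi(x)}=n^x$ for all $n\in N$, $x\in H$. An automorphism $\gamma$ of $G$ extends $\theta$ if $\gamma|_N=\theta$. An automorphism $\gamma$ of $G$ with $\gamma(N)=N$ lifts $\phi\in\mathrm{Aut}(G/N)$ if $\gamma(g)N=\phi(gN)$ for all $g\in G$; it centralizes $N$ if it fixes $N$ elementwise. *)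

(* Defs.v *)
From HB Require Import structures.
From mathcomp Require Import all_boot.
From mathcomp Require Import boolp classical_sets.

Set Implicit Arguments.
Unset Strict Implicit.
Unset Printing Implicit Defensive.

Local Open Scope group_scope.
Local Open Scope quotient_scope.
Local Open Scope classical_set_scope.

(* Groups are arbitrary, possibly infinite, and subgroups are boolean
   predicates; boolp turns any Prop-valued predicate into one. *)
HB.mixin Record isNormalClosed (G : groupType) (S : {pred G}) := {
  gpredJr : forall x g : G, x \in S -> x ^ g \in S
}.

#[short(type="normalClosed")]
HB.structure Definition NormalClosed (G : groupType) :=
  {S of isNormalClosed G S & GroupClosed G S}.

Section Subgroup.
Variables (G : groupType) (S : groupClosed G).

Record subgroup_type := Subgroup {subgroup_val :> G; _ : subgroup_val \in S}.

HB.instance Definition _ := [isSub for subgroup_val].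
HB.instance Definition _ := [Choice of subgroup_type by <:].

Fact subgroup_type_closed : group_closed (fun x : G => x \in S).
Proof. by split; [exact: gpred1 | move=> x y xS yS; exact: gpredF]. Qed.

HB.instance Definition _ :=
  SubChoice_isSubGroup.Build G _ subgroup_type subgroup_type_closed.

End Subgroup.

Section Quotient.
Variables (G : groupType) (N : normalClosed G).

Definition coset_equiv (x y : G) : bool := x^-1 * y \in N.

Fact coset_equiv_is_equiv : equiv_class_of coset_equiv.
Proof.
rewrite /coset_equiv; split=> [x|x y|y x z]; first by rewrite mulVg gpred1.
  by rewrite -gpredV invgM invgK.
by move=> xyN yzN; rewrite -(mulVKg y z) mulgA gpredM.
Qed.

Canonical coset_equiv_equiv := EquivRelPack coset_equiv_is_equiv.
Canonical coset_equiv_encModRel := defaultEncModRel coset_equiv.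

Definition quotg := {eq_quot coset_equiv}.

HB.instance Definition _ : EqQuotient G coset_equiv quotg := EqQuotient.on quotg.
HB.instance Definition _ := Choice.on quotg.

Lemma eq_quotg (x y : G) : (\pi_quotg x = \pi_quotg y) <-> x^-1 * y \in N.
Proof. by split=> [/eqP|xyN]; [rewrite piE | apply/eqP; rewrite piE]. Qed.

Definition quotg_one : quotg := lift_cst quotg 1.
Definition quotg_mul := lift_op2 quotg *%g.
Definition quotg_inv := lift_op1 quotg inv.

Canonical pi_quotg_one_morph := PiConst quotg_one.

Lemma pi_quotg_inv : {morph \pi_quotg : x / x^-1 >-> quotg_inv x}.
Proof.
move=> x; unlock quotg_inv; apply/eq_quotg; set y := repr _.
have /eq_quotg yxN : \pi_quotg y = \pi_quotg x by rewrite reprK.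
by rewrite invgK; have := gpredJr _ y^-1 yxN; rewrite /conjg invgK !mulgA mulgV mul1g.
Qed.
Canonical pi_quotg_inv_morph := PiMorph1 pi_quotg_inv.

Lemma pi_quotg_mul : {morph \pi_quotg : x y / x * y >-> quotg_mul x y}.
Proof.
move=> x y; unlock quotg_mul; apply/eq_quotg; set x' := repr _; set y' := repr _.
have /eq_quotg xN : \pi_quotg x = \pi_quotg x' by rewrite reprK.
have /eq_quotg yN : \pi_quotg y = \pi_quotg y' by rewrite reprK.
have := gpredM _ _ (gpredJr _ y xN) yN.
by rewrite /conjg invgM !mulgA mulgK.
Qed.
Canonical pi_quotg_mul_morph := PiMorph2 pi_quotg_mul.

Fact quotg_mulA : associative quotg_mul.
Proof.
by elim/quotW=> x; elim/quotW=> y; elim/quotW=> z; rewrite !piE mulgA.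
Qed.
Fact quotg_mul1 : left_id quotg_one quotg_mul.
Proof. by elim/quotW=> x; rewrite !piE mul1g. Qed.
Fact quotg_mulr1 : right_id quotg_one quotg_mul.
Proof. by elim/quotW=> x; rewrite !piE mulg1. Qed.
Fact quotg_mulV : left_inverse quotg_one quotg_inv quotg_mul.
Proof. by elim/quotW=> x; rewrite !piE mulVg. Qed.
Fact quotg_mulrV : right_inverse quotg_one quotg_inv quotg_mul.
Proof. by elim/quotW=> x; rewrite !piE mulgV. Qed.

HB.instance Definition _ :=
  isGroup.Build quotg quotg_mulA quotg_mul1 quotg_mulr1 quotg_mulV quotg_mulrV.

Lemma pi_quotgM (x y : G) : \pi_quotg (x * y) = \pi_quotg x * \pi_quotg y.
Proof. exact: pi_quotg_mul. Qed.

Lemma pi_quotg1 : \pi_quotg 1 = 1.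
Proof. by rewrite -[RHS]/quotg_one !piE. Qed.

End Quotient.

(* Right H-modules, written multiplicatively. *)
Record rmodule (H : groupType) := RModule {
  rmod_sort :> groupType;
  ract : rmod_sort -> H -> rmod_sort;
  rmod_mulC : commutative (@mul rmod_sort);
  ract_mul : forall x, {morph ract^~ x : a b / a * b};
  ract1 : forall a, ract a 1 = a;
  ractM : forall a x y, ract a (x * y) = ract (ract a x) y
}.

Section Cohomology2.
Variables (H : groupType) (A : rmodule H).
Local Notation "a ^^ x" := (ract a x) (at level 30, x at level 9).

Fact ract1g x : (1 : A) ^^ x = 1.
Proof. by apply: (mulgI (1 ^^ x)); rewrite -ract_mul !mulg1. Qed.

Fact ractV (a : A) x : a^-1 ^^ x = (a ^^ x)^-1.
Proof. by apply: (mulgI (a ^^ x)); rewrite -ract_mul !mulgV ract1g. Qed.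

Fact rmod_mulACA : interchange (@mul A) (@mul A).
Proof.
by move=> a b c d; rewrite -!mulgA; congr (_ * _); rewrite !mulgA (rmod_mulC b).
Qed.

Definition cochain2 := H -> H -> A.
HB.instance Definition _ := Choice.on cochain2.

Implicit Types f g : cochain2.

Definition cochain2_one : cochain2 := fun _ _ => 1.
Definition cochain2_mul f g : cochain2 := fun x y => f x y * g x y.
Definition cochain2_inv f : cochain2 := fun x y => (f x y)^-1.

Fact cochain2_mulA : associative cochain2_mul.
Proof. by move=> f g h; apply/funext=> x; apply/funext=> y; exact: mulgA. Qed.
Fact cochain2_mul1 : left_id cochain2_one cochain2_mul.
Proof. by move=> f; apply/funext=> x; apply/funext=> y; exact: mul1g. Qed.
Fact cochain2_mulr1 : right_id cochain2_one cochain2_mul.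
Proof. by move=> f; apply/funext=> x; apply/funext=> y; exact: mulg1. Qed.
Fact cochain2_mulV : left_inverse cochain2_one cochain2_inv cochain2_mul.
Proof. by move=> f; apply/funext=> x; apply/funext=> y; exact: mulVg. Qed.
Fact cochain2_mulrV : right_inverse cochain2_one cochain2_inv cochain2_mul.
Proof. by move=> f; apply/funext=> x; apply/funext=> y; exact: mulgV. Qed.

HB.instance Definition _ := isGroup.Build cochain2
  cochain2_mulA cochain2_mul1 cochain2_mulr1 cochain2_mulV cochain2_mulrV.

(* The cocycle identity for a right action: if t is a section of an extension
   of H by A and t x * t y = t (x * y) * f x y, then associativity of
   (t x * t y) * t z is exactly this equation; replacing t by t * c changes f
   by a coboundary. Cochains are not normalized. *)
Definition is_cocycle2 f : Prop := forall x y z : H,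
  f (x * y) z * (f x y) ^^ z = f x (y * z) * f y z.

Definition is_coboundary2 f : Prop := exists c : H -> A, forall x y : H,
  f x y = (c (x * y))^-1 * (c x) ^^ y * c y.

Lemma coboundary2_cocycle2 f : is_coboundary2 f -> is_cocycle2 f.
Proof.
move=> [c fE] x y z; rewrite !fE !ract_mul ractV -ractM -!(mulgA x).
set P := _^-1; set u := c (x * y) ^^ z; set w := c z; set v := c (y * z).
set q := c x ^^ _; set r := c y ^^ z.
have <- : P * q * r * w = P * u * w * (u^-1 * q * r).
  rewrite -(mulgA P u) (rmod_mulC u) -(mulgA u^-1).
  rewrite [RHS](_ : _ = P * w * (q * r)); last first.
    by rewrite !mulgA mulgK.
  by rewrite -[RHS]mulgA (rmod_mulC w) !mulgA.
by rewrite -(mulgA _ r) !mulgA mulgK.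
Qed.

Fact cochain2_mulE f g x y : (f * g) x y = f x y * g x y. Proof. by []. Qed.
Fact cochain2_invE f x y : f^-1 x y = (f x y)^-1. Proof. by []. Qed.

Definition cocycles2 : {pred cochain2} := fun f => `[< is_cocycle2 f >].

Fact cocycles2_1 : 1 \in cocycles2.
Proof. by apply/asboolP => x y z; rewrite ract1g. Qed.
Fact cocycles2_M : mulg_closed cocycles2.
Proof.
move=> f g /asboolP fZ /asboolP gZ; apply/asboolP => x y z.
by rewrite !cochain2_mulE ract_mul rmod_mulACA fZ gZ rmod_mulACA.
Qed.
Fact cocycles2_V : invg_closed cocycles2.
Proof.
move=> f /asboolP fZ; apply/asboolP => x y z.
by rewrite !cochain2_invE ractV -!invgM rmod_mulC fZ rmod_mulC.
Qed.

HB.instance Definition _ := isMulClosed.Build cochain2 cocycles2 cocycles2_M.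
HB.instance Definition _ := isMul1Closed.Build cochain2 cocycles2 cocycles2_1.
HB.instance Definition _ := isInvClosed.Build cochain2 cocycles2 cocycles2_V.

Definition Z2 := subgroup_type cocycles2.

(* Carved out of Z2 rather than of cochain2, so that the quotient H2 is formed;
   by coboundary2_cocycle2 no coboundary is lost. *)
Definition coboundaries2 : {pred Z2} :=
  fun z : Z2 => `[< is_coboundary2 (subgroup_val z) >].

Fact coboundaries2_1 : 1 \in coboundaries2.
Proof. by apply/asboolP; exists (fun=> 1) => x y; rewrite ract1g !mulg1 invg1. Qed.
Fact coboundaries2_M : mulg_closed coboundaries2.
Proof.
move=> f g /asboolP[c fE] /asboolP[d gE]; apply/asboolP.
exists (fun x => c x * d x) => x y.
rewrite [LHS](_ : _ = subgroup_val f x y * subgroup_val g x y)// fE gE.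
rewrite invgM (rmod_mulC (d (x * y))^-1 (c (x * y))^-1) ract_mul.
by rewrite rmod_mulACA (rmod_mulACA (c (x * y))^-1).
Qed.
Fact coboundaries2_V : invg_closed coboundaries2.
Proof.
move=> f /asboolP[c fE]; apply/asboolP; exists (fun x => (c x)^-1) => x y.
rewrite [LHS](_ : _ = (subgroup_val f x y)^-1)// fE ractV !invgM.
by rewrite rmod_mulC (rmod_mulC (c x ^^ y)^-1).
Qed.
Fact coboundaries2_J (f g : Z2) :
  f \in coboundaries2 -> f ^ g \in coboundaries2.
Proof.
suff -> : f ^ g = f by [].
apply/val_inj/funext=> x; apply/funext=> y; rewrite /conjg mulgA.
rewrite [LHS](_ : _ = (subgroup_val g x y)^-1 * subgroup_val f x y
  * subgroup_val g x y)//.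
by rewrite rmod_mulC mulVKg.
Qed.

HB.instance Definition _ := isMulClosed.Build Z2 coboundaries2 coboundaries2_M.
HB.instance Definition _ := isMul1Closed.Build Z2 coboundaries2 coboundaries2_1.
HB.instance Definition _ := isInvClosed.Build Z2 coboundaries2 coboundaries2_V.
HB.instance Definition _ := isNormalClosed.Build Z2 coboundaries2 coboundaries2_J.

Definition H2 := quotg coboundaries2.

End Cohomology2.

Section ConjugationModule.
Variables (G : groupType) (N : normalClosed G).
Local Notation G_N := (quotg N).

(* n ^ x is conjugation by the canonical representative of the coset x. *)
Definition conjN (n : subgroup_type N) (x : G_N) : subgroup_type N :=
  Subgroup (gpredJr (subgroup_val n) (repr x) (valP n)).

Hypothesis abN : {in N &, commutative mul}.

(* The choice of representative is immaterial since N is abelian. *)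
Lemma conjN_pi (n : subgroup_type N) (g : G) :
  conjN n (\pi_G_N g) = (n : G) ^ g :> G.
Proof.
rewrite /=; set h := repr _.
have /eq_quotg hgN : \pi_G_N h = \pi_G_N g by rewrite reprK.
have nhN : subgroup_val n ^ h \in N by apply/gpredJr/(valP n).
rewrite -[in RHS](mulVKg h g) conjgM [RHS]/conjg.
by rewrite (abN nhN hgN) mulKg.
Qed.

Fact subgroup_mulC : commutative (@mul (subgroup_type N)).
Proof. by move=> m n; apply/val_inj/abN; exact: valP. Qed.

Fact conjN_mul x : {morph conjN^~ x : m n / m * n}.
Proof. by move=> m n; apply/val_inj; rewrite /= conjMg. Qed.

Fact conjN1 n : conjN n 1 = n.
Proof. by apply/val_inj; rewrite -(pi_quotg1 N) [LHS](conjN_pi n 1) conjg1. Qed.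

Fact conjNM n x y : conjN n (x * y) = conjN (conjN n x) y.
Proof.
elim/quotW: x => x; elim/quotW: y => y; rewrite -pi_quotgM.
by apply/val_inj; rewrite [LHS]conjN_pi [RHS]conjN_pi conjN_pi conjgM.
Qed.

Definition conj_rmodule : rmodule G_N :=
  RModule subgroup_mulC conjN_mul conjN1 conjNM.

End ConjugationModule.

Record aut (G : groupType) := Aut {
  aut_fun :> {multiplicative G -> G};
  aut_bij : bijective aut_fun
}.

Section ExtendLift.
Variables (G : groupType) (N : normalClosed G).
Local Notation G_N := (quotg N).

Definition C1 : set (aut (subgroup_type N)) :=
  [set theta : aut (subgroup_type N) | forall n x, theta (conjN n x) = conjN (theta n) x].

Definition C2 : set (aut G_N) :=
  [set phi : aut G_N | forall n x, conjN n (phi x) = conjN n x].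

Definition extends_aut (gamma : aut G) (theta : aut (subgroup_type N)) : Prop :=
  forall n : subgroup_type N, gamma (n : G) = (theta n : subgroup_type N) :> G.

Definition lifts_fun (gamma : aut G) (phi : G_N -> G_N) : Prop :=
  gamma @` [set n : G | n \in N] = [set n : G | n \in N] /\
  forall g : G, \pi_G_N (gamma g) = phi (\pi_G_N g).

Definition induces_id (gamma : aut G) : Prop := lifts_fun gamma id.

Definition centralizes (gamma : aut G) : Prop := {in N, gamma =1 id}.

End ExtendLift.

Arguments conj_rmodule {G} N abN.
Arguments C1 {G} N.
Arguments C2 {G} N.
Arguments lifts_fun {G} N gamma phi.
Arguments induces_id {G} N gamma.
Arguments centralizes {G} N gamma.

(* Main.v *)
(* If H^2(G/N, N) is trivial then N has a complement, i.e. the projection has a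
   multiplicative section s. Every g is then uniquely s x * n with n in N, and a
   pair (theta, phi) with theta (n ^ x) = theta n ^ phi x acts on G by
   s x * n |-> s (phi x) * theta n. The two claims are the cases phi = id and
   theta = id. *)
Require Import Defs.
From HB Require Import structures.
From mathcomp Require Import all_boot.
From mathcomp Require Import boolp classical_sets.

Local Open Scope group_scope.
Local Open Scope quotient_scope.

Set Implicit Arguments.
Unset Strict Implicit.
Unset Printing Implicit Defensive.

Lemma quotg_eq1 (G : groupType) (N : normalClosed G) (g : G) :
  \pi_(quotg N) g = 1 <-> g \in N.
Proof. by rewrite -(pi_quotg1 N) eq_quotg mulg1 gpredV. Qed.

Lemma H2_trivial_coboundary (H : groupType) (A : rmodule H) :
  (forall c : H2 A, c = 1) ->
  forall f : cochain2 A, is_cocycle2 f -> is_coboundary2 f.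
Proof.
move=> triv f /asboolP fZ; have {}fZ : f \in @cocycles2 _ A by [].
pose z : Z2 A := Subgroup fZ.
by have /quotg_eq1/asboolP := triv (\pi_(quotg (@coboundaries2 _ A)) z).
Qed.

Section Complement.
Context {G : groupType} (N : normalClosed G).
Local Notation G_N := (quotg N).
Implicit Types (x y : G_N) (g : G).

(** The factor set of the section [repr]. It is not normalized, since [repr 1] may differ from
    [1]. *)
Definition factor_set_val x y : G := (repr (x * y))^-1 * (repr x * repr y).

Lemma factor_set_in x y : factor_set_val x y \in N.
Proof. by apply/eq_quotg; rewrite pi_quotgM !reprK. Qed.

Definition factor_set x y : subgroup_type N := Subgroup (factor_set_in x y).

Hypothesis abN : {in N &, commutative (@mul G)}.

(** [conjN] is built on [repr]; since [N] is abelian, the multiplicative section found below can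
    stand in for it. *)
Lemma conjN_section (s : G_N -> G) : cancel s \pi_G_N ->
  forall n x, conjN n x = (n : G) ^ s x :> G.
Proof. by move=> sK n x; rewrite -(conjN_pi abN) sK. Qed.

(** Both sides telescope to [(repr (x * y * z))^-1 * repr x * repr y * repr z]. *)
Lemma factor_set_cocycle : is_cocycle2 (A := conj_rmodule N abN) factor_set.
Proof.
move=> x y z; apply/val_inj => /=.
rewrite -[LHS]/(factor_set_val _ _ * factor_set_val _ _ ^ repr z).
rewrite -[RHS]/(factor_set_val _ _ * factor_set_val _ _).
by rewrite /factor_set_val /conjg !mulgA !mulgK.
Qed.

Lemma split_of_H2_trivial : (forall c : H2 (conj_rmodule N abN), c = 1) ->
  exists s : G_N -> G, cancel s \pi_G_N /\ {morph s : x y / x * y}.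
Proof.
move=> triv; have [c fE] := H2_trivial_coboundary triv factor_set_cocycle.
(* The factor set of [repr] is the coboundary of [c], so dividing [repr] by [c] makes it trivial. *)
exists (fun x => repr x * (c x : G)^-1); split=> [x|x y].
  rewrite pi_quotgM reprK (_ : \pi_G_N _ = 1) ?mulg1 //.
  by apply/quotg_eq1; rewrite gpredV; exact: valP.
(* The last two factors are swapped because moving [repr y] to the left in the product of the two
   values leaves [(c x ^ repr y)^-1 * (c y)^-1], the inverse of the swapped product. *)
have fxy : factor_set_val x y =
    (c (x * y) : G)^-1 * ((c y : G) * (c x : G) ^ repr y).
  rewrite (abN (valP (c y)) (valP (conjN (c x) y))) mulgA.
  exact: (congr1 (@subgroup_val _ N) (fE x y)).
have cxyE : (c (x * y) : G)^-1 =
    factor_set_val x y / ((c y : G) * (c x : G) ^ repr y).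
  by rewrite fxy mulgK.
by rewrite cxyE /factor_set_val /conjg !invgM !invgK !mulgA mulgV mul1g !mulgK.
Qed.

Section ExtendLift.
Variables (s : G_N -> G) (sK : cancel s \pi_G_N) (sM : {morph s : x y / x * y}).

Lemma kernel_part_in g : (s (\pi_G_N g))^-1 * g \in N.
Proof. by apply/eq_quotg; rewrite sK. Qed.

Definition kernel_part g : subgroup_type N := Subgroup (kernel_part_in g).

Lemma kernel_part_mul x (n : subgroup_type N) :
  \pi_G_N (s x * (n : G)) = x /\ kernel_part (s x * (n : G)) = n.
Proof.
have pisn : \pi_G_N (s x * (n : G)) = x.
  by rewrite pi_quotgM sK (quotg_eq1 N (n : G)).2 ?mulg1 //; exact: valP.
by split=> //; apply/val_inj; rewrite /= pisn mulKg.
Qed.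

Lemma kernel_partE g : g = s (\pi_G_N g) * (kernel_part g : G).
Proof. by rewrite /= mulVKg. Qed.

(** The semidirect product law: [s x * m * (s y * n) = s (x * y) * (m ^ s y * n)]. *)
Lemma kernel_partM g h :
  kernel_part (g * h) = conjN (kernel_part g) (\pi_G_N h) * kernel_part h.
Proof.
apply/val_inj => /=; rewrite [RHS](_ : _ =
  (conjN (kernel_part g) (\pi_G_N h) : G) * (kernel_part h : G)) //.
rewrite (conjN_section sK) /= pi_quotgM sM /conjg !invgM.
by rewrite !mulgA mulgK.
Qed.

Definition glue (theta : subgroup_type N -> subgroup_type N) (phi : G_N -> G_N)
  (g : G) : G := s (phi (\pi_G_N g)) * (theta (kernel_part g) : G).

Lemma glueK theta theta' phi phi' : cancel theta theta' -> cancel phi phi' ->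
  cancel (glue theta phi) (glue theta' phi').
Proof.
move=> thetaK phiK g; rewrite /glue.
have [-> ->] := kernel_part_mul (phi (\pi_G_N g)) (theta (kernel_part g)).
by rewrite phiK thetaK -kernel_partE.
Qed.

(** The compatibility condition is what allows [theta m] to move past [s (phi y)], turning into
    [theta (m ^ y)]. *)
Lemma glueM (theta : {multiplicative subgroup_type N -> subgroup_type N})
    (phi : {multiplicative G_N -> G_N}) :
  (forall n x, theta (conjN n x) = conjN (theta n) (phi x)) ->
  {morph glue theta phi : g h / g * h}.
Proof.
move=> compat g h; rewrite /glue kernel_partM !gmulfM compat pi_quotgM gmulfM sM.
rewrite [X in _ * X](_ : _ =
  (conjN (theta (kernel_part g)) (phi (\pi_G_N h)) : G) * (theta (kernel_part h) : G)) // (conjN_section sK).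
by rewrite /conjg !mulgA mulgK.
Qed.

Lemma exists_aut_extends_lifts (theta : aut (subgroup_type N)) (phi : aut G_N) :
  (forall n x, theta (conjN n x) = conjN (theta n) (phi x)) ->
  exists gamma : aut G, extends_aut gamma theta /\ lifts_fun N gamma phi.
Proof.
move=> compat; have [theta' thetaK theta'K] := aut_bij theta.
have [phi' phiK phi'K] := aut_bij phi.
pose gammaM := isMultiplicative.Build G G _ (glueM compat).
pose gamma : {multiplicative G -> G} := HB.pack (glue theta phi) gammaM.
have gammaK' : cancel (glue theta' phi') gamma by exact: glueK.
have gamma_bij : bijective gamma by exists (glue theta' phi') => //; exact: glueK.
have pi_gamma g : \pi_G_N (gamma g) = phi (\pi_G_N g).
  by have [] := kernel_part_mul (phi (\pi_G_N g)) (theta (kernel_part g)).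
have phi1 : phi 1 = 1 by apply: (mulgI (phi 1)); rewrite -gmulfM !mulg1.
have s1 : s 1 = 1 by apply: (mulgI (s 1)); rewrite -sM !mulg1.
exists (Aut gamma_bij); split=> [n|].
  (* Since [s 1 = 1], an element [n] of [N] decomposes as [s 1 * n] and is its own kernel part. *)
  have [pin kn] := kernel_part_mul 1 n; rewrite s1 mul1g in pin kn.
  by rewrite /= /glue pin kn phi1 s1 mul1g.
split=> //; apply/seteqP; split=> [_ [g /quotg_eq1 gN <-]|g /quotg_eq1 gN] /=.
  by apply/quotg_eq1; rewrite pi_gamma gN phi1.
(* The preimage of [g] under [gamma] lies in [N] because [phi] is injective and sends its coset to
   [1]. *)
exists (glue theta' phi' g); last exact: gammaK'.
by apply/quotg_eq1/(bij_inj (aut_bij phi)); rewrite phi1 -pi_gamma gammaK'.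
Qed.

End ExtendLift.

End Complement.

Definition id_aut (G : groupType) : aut G := @Aut G idfun (inv_bij (frefl _)).

Theorem corollary3 (G : groupType) (N : normalClosed G)
    (abN : {in N &, commutative (@mul G)})
    (H2_trivial : forall c : H2 (conj_rmodule N abN), c = 1) :
  (forall theta : aut (subgroup_type N), C1 N theta ->
     exists gamma : aut G, extends_aut gamma theta /\ induces_id N gamma) /\
  (forall phi : aut (quotg N), C2 N phi ->
     exists gamma : aut G, lifts_fun N gamma phi /\ centralizes N gamma).
Proof.
have [s [sK sM]] := split_of_H2_trivial H2_trivial.
split=> [theta thetaC | phi phiC].
  exact: (exists_aut_extends_lifts abN sK sM (phi := id_aut _) thetaC).
have [n x|gamma [ext lift]] :=
    @exists_aut_extends_lifts _ _ abN _ sK sM (id_aut _) phi.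
  by rewrite /= phiC.
(* Extending the identity of [N] amounts to centralizing [N]. *)
by exists gamma; split=> // n nN; exact: (ext (Subgroup nN)).
Qed.
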